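(* Let $a,b,c,d$ be distinct variables. Then the sequent $d \to d \cdot b \cdot \bigl((c \cdot b) \wedge (a \backslash a)\bigr) \cdot c$ semantically follows from the hypothesis $a \backslash a \to b \cdot c$ on the class of square R-models, but it does not syntactically follow from $a \backslash a \to b \cdot c$ in the calculus $\mathbf{L}^{\!\Lambda}\wedge\mathbf{0}\mathbf{1}$. Consequently, the calculus $\mathbf{L}^{\!\Lambda}\wedge$ (the fragment without the constants $\mathbf{0},\mathbf{1}$) is not strongly complete w.r.t. square R-models, and $\mathbf{L}^{\!\Lambda}\wedge\mathbf{0}\mathbf{1}$ is not strongly complete w.r.t. non-standard square R-models.
   Context: Formulae are built from variables and the constants $\mathbf{0}$, $\mathbf{1}$ using the binary connectives $\cdot$ (product), $\backslash$, $/$ (left and right division), $\wedge$ (intersection). Sequents are $\Pi \to B$ with $\Pi$ a possibly empty sequence of formulae. $\mathbf{L}^{\!\Lambda}\wedge\mathbf{0}\mathbf{1}$ is the Lambek calculus allowing empty antecedents, extended with intersection and constants, given by the Gentzen-style axioms and rules: $A \to A$; Cut; $\backslash L$: from $\Pi \to A$ and $\Gamma, B, \Delta \to C$ infer $\Gamma, \Pi, A\backslash B, \Delta \to C$; $\backslash R$: from $A,\Pi \to B$ infer $\Pi \to A \backslash B$ (symmetric rules for $/$); $\cdot L$: from $\Gamma, A, B, \Delta \to C$ infer $\Gamma, A\cdot B, \Delta \to C$; $\cdot R$: from $\Pi \to A$ and $\Delta \to B$ infer $\Pi,\Delta \to A \cdot B$; $\wedge L_{1,2}$: from $\Gamma,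 A, \Delta \to C$ (resp. $\Gamma,B,\Delta\to C$) infer $\Gamma, A\wedge B, \Delta \to C$; $\wedge R$: from $\Pi \to A$ and $\Pi \to B$ infer $\Pi \to A \wedge B$; $\mathbf{0}L$: $\Gamma,\mathbf{0},\Delta \to C$; $\mathbf{1}L$: from $\Gamma,\Delta\to C$ infer $\Gamma,\mathbf{1},\Delta \to C$; $\mathbf{1}R$: $\Lambda \to \mathbf{1}$ ($\Lambda$ = empty sequence). A sequent syntactically follows from a set of hypotheses $\mathcal{H}$ if it is derivable with the sequents of $\mathcal{H}$ added as extra axioms. A square R-model is $(W, v)$ with $W\neq\varnothing$ and $v$ mapping formulae to binary relations on $W$ such that $v(A\cdot B)=v(A)\circ v(B)$, $v(A\backslash B)=\{(y,z)\mid \forall x\,((x,y)\in v(A)\Rightarrow (x,z)\in v(B))\}$, $v(B/A)=\{(x,y)\mid \forall z\,((y,z)\in v(A)\Rightarrow (x,z)\in v(B))\}$, $v(A\wedge B)=v(A)\cap v(B)$. A sequent $A_1,\dots,A_n\to B$ is true if $v(A_1)\circ\dots\circ v(A_n)\subseteq v(B)$, and $\Lambda \to B$ is true if the diagonal $\delta=\{(x,x)\mid x\in W\}\subseteq v(B)$. A non-standard square R-model additionally has a family $\mathfrak{A}$ of relations on $W$ closed under $\circ,\backslash,/,\cap$ containing all values of $v$, with $v(\mathbf{1})$ being the $\mathfrak{A}$-unit (neutral for $\circ$ on $\mathfrak{A}$) and $v(\mathbf{0})$ the $\mathfrak{A}$-zero (included in every member of $\mathfrak{A}$). A sequent semantically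 follows from $\mathcal{H}$ on a class of models if it is true in every model of the class in which all sequents of $\mathcal{H}$ are true. Strong completeness means semantic consequence implies syntactic consequence. *)

(* Defs.v *)
From Stdlib Require Import List Relations.
Import ListNotations.

(** The flag [k] selects the language: [formula true] has the constants 0 and 1,
    [formula false] is the constant-free fragment. *)
Inductive formula (k : bool) : Type :=
| Var (n : nat)
| Zero (hk : k = true)
| One (hk : k = true)
| Prod (A B : formula k)
| Under (A B : formula k)
| Over (B A : formula k)
| Meet (A B : formula k).

Arguments Var {k} n.
Arguments Zero {k} hk.
Arguments One {k} hk.
Arguments Prod {k} A B.
Arguments Under {k} A B.
Arguments Over {k} B A.
Arguments Meet {k} A B.

Declare Scope lambek_scope.
Delimit Scope lambek_scope with L.
Bind Scope lambek_scope with formula.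
Notation "A ⋅ B" := (Prod A B) (at level 40, left associativity) : lambek_scope.
Notation "A \\ B" := (Under A B) (at level 45, no associativity) : lambek_scope.
Notation "B ∕ A" := (Over B A) (at level 45, no associativity) : lambek_scope.
Notation "A ⊓ B" := (Meet A B) (at level 50, left associativity) : lambek_scope.

Record sequent (k : bool) : Type := Seq {
  antecedent : list (formula k);
  succedent : formula k
}.

Arguments Seq {k} antecedent succedent.
Arguments antecedent {k} s.
Arguments succedent {k} s.

Notation "P ⟶ B" := (Seq P%list B%L) (at level 80, no associativity).

(** Derivability from the hypotheses [H], all formulae (cut formulae included)
    being taken in the language [k]: [L^Λ∧01] for [k = true] and [L^Λ∧] for
    [k = false]. *)
Inductive derivable {k : bool} (H : sequent k -> Prop) : sequent k -> Prop :=
| d_hyp s : H s -> derivable H s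
| d_ax A : derivable H ([A] ⟶ A)
| d_cut P G D A C :
    derivable H (P ⟶ A) -> derivable H (G ++ [A] ++ D ⟶ C) ->
    derivable H (G ++ P ++ D ⟶ C)
| d_underL P G D A B C :
    derivable H (P ⟶ A) -> derivable H (G ++ [B] ++ D ⟶ C) ->
    derivable H (G ++ P ++ [(A \\ B)%L] ++ D ⟶ C)
| d_underR P A B :
    derivable H ([A] ++ P ⟶ B) -> derivable H (P ⟶ A \\ B)
| d_overL P G D A B C :
    derivable H (P ⟶ A) -> derivable H (G ++ [B] ++ D ⟶ C) ->
    derivable H (G ++ [(B ∕ A)%L] ++ P ++ D ⟶ C)
| d_overR P A B :
    derivable H (P ++ [A] ⟶ B) -> derivable H (P ⟶ B ∕ A)
| d_prodL G D A B C :
    derivable H (G ++ [A; B] ++ D ⟶ C) ->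
    derivable H (G ++ [(A ⋅ B)%L] ++ D ⟶ C)
| d_prodR P D A B :
    derivable H (P ⟶ A) -> derivable H (D ⟶ B) ->
    derivable H (P ++ D ⟶ A ⋅ B)
| d_meetL1 G D A B C :
    derivable H (G ++ [A] ++ D ⟶ C) ->
    derivable H (G ++ [(A ⊓ B)%L] ++ D ⟶ C)
| d_meetL2 G D A B C :
    derivable H (G ++ [B] ++ D ⟶ C) ->
    derivable H (G ++ [(A ⊓ B)%L] ++ D ⟶ C)
| d_meetR P A B :
    derivable H (P ⟶ A) -> derivable H (P ⟶ B) ->
    derivable H (P ⟶ A ⊓ B)
| d_zeroL (hk : k = true) G D C :
    derivable H (G ++ [Zero hk] ++ D ⟶ C)
| d_oneL (hk : k = true) G D C :
    derivable H (G ++ D ⟶ C) -> derivable H (G ++ [One hk] ++ D ⟶ C)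
| d_oneR (hk : k = true) :
    derivable H ([] ⟶ One hk).

Section Relations.
Context {W : Type}.
Implicit Types R S : relation W.

Definition rcomp R S : relation W := fun x z => exists y, R x y /\ S y z.
Definition runder R S : relation W := fun y z => forall x, R x y -> S x z.
Definition rover S R : relation W := fun x y => forall z, R y z -> S x z.
Definition rcap R S : relation W := fun x y => R x y /\ S x y.
Definition diagonal : relation W := fun x y => x = y.
End Relations.

(** No condition is put on the values of the constants. *)
Record square_Rmodel (k : bool) : Type := SquareRmodel {
  carrier : Type;
  carrier_nonempty : inhabited carrier;
  val : formula k -> relation carrier;
  val_prod A B : same_relation _ (val (A ⋅ B)) (rcomp (val A) (val B));
  val_under A B : same_relation _ (val (A \\ B)) (runder (val A) (val B));
  val_over A B : same_relation _ (val (B ∕ A)) (rover (val B) (val A));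
  val_meet A B : same_relation _ (val (A ⊓ B)) (rcap (val A) (val B))
}.

Arguments carrier {k} s.
Arguments val {k} s A _ _.

Fixpoint val_seq {k} (M : square_Rmodel k) (P : list (formula k)) :
    relation (carrier M) :=
  match P with
  | [] => diagonal
  | [A] => val M A
  | A :: P' => rcomp (val M A) (val_seq M P')
  end.

Definition true_in {k} (M : square_Rmodel k) (s : sequent k) : Prop :=
  inclusion _ (val_seq M (antecedent s)) (val M (succedent s)).

Record nonstandard_family (M : square_Rmodel true)
    (F : relation (carrier M) -> Prop) : Prop := NonstandardFamily {
  fam_comp R S : F R -> F S -> F (rcomp R S);
  fam_under R S : F R -> F S -> F (runder R S);
  fam_over S R : F S -> F R -> F (rover S R);
  fam_cap R S : F R -> F S -> F (rcap R S);
  fam_val A : F (val M A);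
  fam_unitl R : F R -> same_relation _ (rcomp (val M (One eq_refl)) R) R;
  fam_unitr R : F R -> same_relation _ (rcomp R (val M (One eq_refl))) R;
  fam_zero R : F R -> inclusion _ (val M (Zero eq_refl)) R
}.

Definition any_square {k} : square_Rmodel k -> Prop := fun _ => True.

(** Truth of sequents does not depend on the choice of the family. *)
Definition nonstandard_square (M : square_Rmodel true) : Prop :=
  exists F, nonstandard_family M F.

Definition semantically_follows {k} (Mods : square_Rmodel k -> Prop)
    (H : sequent k -> Prop) (s : sequent k) : Prop :=
  forall M, Mods M -> (forall h, H h -> true_in M h) -> true_in M s.

Definition strongly_complete {k} (Mods : square_Rmodel k -> Prop) : Prop :=
  forall H s, semantically_follows Mods H s -> derivable H s.

Definition hypothesis {k} (a b c : nat) : sequent k :=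
  [(Var a \\ Var a)%L] ⟶ Var b ⋅ Var c.

Definition conclusion {k} (a b c d : nat) : sequent k :=
  [Var d] ⟶
    Var d ⋅ Var b ⋅ ((Var c ⋅ Var b) ⊓ (Var a \\ Var a)) ⋅ Var c.

(* Main.v *)
Require Import Defs.
From Stdlib Require Import List Relations Arith Lia.
Import ListNotations.

(** Semantically: [a \ a] contains the diagonal, so every point [y] has some [z]
    with [(y, z)] in [b] and [(z, y)] in [c]; the loop [(z, z)] then lies in
    [(c b) /\ (a \ a)], so any pair [(x, y)] of [d] can be followed by
    [y -> z -> z -> y].
    Syntactically: the calculus is sound for the subsets of any monoid.  In the
    bicyclic monoid, generated by [p] and [q] with [p q = 1] and [q p <> 1], put
    [a = d = {1}], [b = {p}] and [c = {q}].  Then [a \ a = {1} = b c], whereas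
    [(c b) /\ (a \ a)] is empty. *)

Record monoid : Type := Monoid {
  elt :> Type;
  op : elt -> elt -> elt;
  unit : elt;
  opA x y z : op x (op y z) = op (op x y) z;
  op1l x : op unit x = x;
  op1r x : op x unit = x
}.

Arguments op {m} _ _.
Arguments unit {m}.

Section PowersetSemantics.
Context {k : bool} {M : monoid} (v : nat -> M -> Prop).

(** [Zero] is the empty set because a product with an empty factor is empty, which validates
    [d_zeroL]. *)
Fixpoint interp (A : formula k) : M -> Prop :=
  match A with
  | Var n => v n
  | Zero _ => fun _ => False
  | One _ => fun x => x = unit
  | Prod A B => fun x => exists y z, x = op y z /\ interp A y /\ interp B z
  | Under A B => fun x => forall y, interp A y -> interp B (op y x)
  | Over B A => fun x => forall y, interp A y -> interp B (op x y)
  | Meet A B => fun x => interp A x /\ interp B x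
  end.

Fixpoint interp_list (P : list (formula k)) : M -> Prop :=
  match P with
  | [] => fun x => x = unit
  | A :: P' => fun x => exists y z, x = op y z /\ interp A y /\ interp_list P' z
  end.

Definition valid (s : sequent k) : Prop :=
  forall x, interp_list (antecedent s) x -> interp (succedent s) x.

Lemma interp_list1 A x : interp_list [A] x <-> interp A x.
Proof.
  simpl; split.
  - intros (y & z & -> & Hy & ->); now rewrite op1r.
  - intros Hx; exists x, unit; now rewrite op1r.
Qed.

Lemma interp_list_app P Q x :
  interp_list (P ++ Q) x <->
  exists y z, x = op y z /\ interp_list P y /\ interp_list Q z.
Proof.
  revert x; induction P as [|A P IH]; simpl; intros x; split.
  - intros Hx; exists unit, x; now rewrite op1l.
  - intros (y & z & -> & -> & Hz); now rewrite op1l.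
  - intros (y & z & -> & Hy & (z1 & z2 & -> & H1 & H2)%IH).
    exists (op y z1), z2; rewrite opA; eauto 10.
  - intros (? & z & -> & (y1 & y2 & -> & H1 & H2) & Hz).
    exists y1, (op y2 z); rewrite opA, IH; eauto 10.
Qed.

(** Products of subsets are monotone in each factor. Hence for cut, and for every left rule except
    [d_zeroL], only the block of formulae being rewritten has to be compared. *)
Lemma valid_replace P Q G D C :
  (forall x, interp_list P x -> interp_list Q x) ->
  valid (G ++ Q ++ D ⟶ C) -> valid (G ++ P ++ D ⟶ C).
Proof.
  intros HPQ HC x Hx; apply HC; revert Hx; simpl.
  rewrite !interp_list_app; intros (y & z & -> & Hy & Hz).
  exists y, z; repeat split; trivial; revert Hz.
  rewrite !interp_list_app; intros (z1 & z2 & -> & Hz1 & Hz2); eauto 10.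
Qed.

Theorem derivable_valid (H : sequent k -> Prop) s :
  (forall h, H h -> valid h) -> derivable H s -> valid s.
Proof.
  intros HH; induction 1 as
    [ s Hs | A | P G D A C _ IHA _ IHC | P G D A B C _ IHA _ IHC
    | P A B _ IH | P G D A B C _ IHA _ IHC | P A B _ IH | G D A B C _ IH
    | P D A B _ IHA _ IHB | G D A B C _ IH | G D A B C _ IH
    | P A B _ IHA _ IHB | hk G D C | hk G D C _ IH | hk ].
  - now apply HH.
  - intros x; apply interp_list1.
  - apply (valid_replace P [A]); trivial.
    intros x Hx; apply interp_list1, IHA, Hx.
  (* [P] and the division form one block, whose product lies inside [B]. *)
  - rewrite (app_assoc P); apply (valid_replace _ [B]); trivial.
    intros x (y & z & -> & Hy & Hz)%interp_list_app.
    apply interp_list1; apply interp_list1 in Hz; apply Hz, IHA, Hy.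
  - intros x Hx y Hy; apply IH; simpl; eauto 10.
  - rewrite (app_assoc _ P); apply (valid_replace _ [B]); trivial.
    intros x (y & z & -> & Hy & Hz)%interp_list_app.
    apply interp_list1; apply interp_list1 in Hy; apply Hy, IHA, Hz.
  - intros x Hx y Hy; apply IH; simpl; apply interp_list_app.
    exists x, y; rewrite interp_list1; auto.
  - apply (valid_replace _ [A; B]); trivial.
    intros x (y & z & -> & Hy & Hz)%interp_list1.
    apply (interp_list_app [A] [B]); exists y, z; rewrite !interp_list1; auto.
  - intros x (y & z & -> & Hy & Hz)%interp_list_app.
    exists y, z; repeat split; [apply IHA | apply IHB]; trivial.
  - apply (valid_replace _ [A]); trivial.
    intros x Hx%interp_list1; apply interp_list1, Hx.
  - apply (valid_replace _ [B]); trivial.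
    intros x Hx%interp_list1; apply interp_list1, Hx.
  - intros x Hx; split; [apply IHA | apply IHB]; trivial.
  - intros x (y & z & -> & _ & Hz)%interp_list_app.
    apply interp_list_app in Hz as (z1 & z2 & _ & Hz1 & _).
    apply interp_list1 in Hz1 as [].
  - apply (valid_replace _ []); trivial.
    intros x Hx%interp_list1; exact Hx.
  - intros x Hx; exact Hx.
Qed.
End PowersetSemantics.

(** The pair [(i, j)] stands for [q^i p^j]. *)
Definition bicyclic_op (x y : nat * nat) : nat * nat :=
  (fst x + (fst y - snd x), snd y + (snd x - fst y)).

(** An inner [p^j q^i] cancels to [q^(i - j) p^(j - i)] with truncated subtraction. The definition
    is transparent so that later steps can compute products. *)
Definition bicyclic : monoid.
Proof.
  refine (@Monoid (nat * nat) bicyclic_op (0, 0) _ _ _); unfold bicyclic_op.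
  - intros [x1 x2] [y1 y2] [z1 z2]; cbn [fst snd]; f_equal; lia.
  - intros [x1 x2]; cbn [fst snd]; f_equal; lia.
  - intros [x1 x2]; cbn [fst snd]; f_equal; lia.
Defined.

(** The default [(0, 0)], the unit, is meant for [a] and [d]. *)
Definition bicyclic_val (b c : nat) (n : nat) (x : bicyclic) : Prop :=
  x = if n =? b then (0, 1) else if n =? c then (1, 0) else (0, 0).

Lemma conclusion_not_derivable k a b c d :
  NoDup [a; b; c; d] ->
  ~ derivable (eq (@hypothesis k a b c)) (@conclusion k a b c d).
Proof.
  intros Hd Hder.
  assert (Hneq : a <> b /\ a <> c /\ d <> b /\ d <> c /\ c <> b).
  { inversion_clear Hd as [|? ? Ha Hd']; inversion_clear Hd' as [|? ? Hb Hd].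
    inversion_clear Hd as [|? ? Hc _]; simpl in *; intuition congruence. }
  destruct Hneq as (ab & ac & db & dc & cb).
  apply Nat.eqb_neq in ab, ac, db, dc, cb.
  apply (derivable_valid (bicyclic_val b c)) in Hder.
  - specialize (Hder (0, 0)); cbn [conclusion antecedent succedent] in Hder.
    rewrite interp_list1 in Hder; cbn [interp] in Hder; unfold bicyclic_val in Hder.
    rewrite ab, ac, db, dc, cb, !Nat.eqb_refl in Hder.
    destruct (Hder eq_refl) as (y & z & _ & (y1 & y2 & _ & _ & Hy2) & _).
    (* The factor in the meet is [q p = (1, 1)], but [a \ a] forces it to be [(0, 0)]. *)
    destruct Hy2 as [(u & w & -> & -> & ->) Hu].
    discriminate (Hu _ eq_refl).
  - intros h <- x Hx; cbn [hypothesis antecedent succedent] in *.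
    rewrite interp_list1 in Hx; cbn [interp] in *; unfold bicyclic_val in *.
    rewrite ab, ac, cb, !Nat.eqb_refl in *.
    (* [p q] computes to the unit, and [x] is the unit since it maps the unit in [a] back into
       [a]. *)
    exists (0, 1), (1, 0); repeat split.
    specialize (Hx _ eq_refl); now rewrite (op1l bicyclic) in Hx.
Qed.

(** Keeping [Mods] arbitrary lets one argument serve both square and non-standard models. *)
Lemma conclusion_semantically_follows k (Mods : square_Rmodel k -> Prop) a b c d :
  semantically_follows Mods (eq (hypothesis a b c)) (conclusion a b c d).
Proof.
  intros M _ HM x y Hd; simpl in *.
  assert (Hloop : forall w, val M (Var a \\ Var a)%L w w).
  { intros w; apply val_under; intros u Hu; exact Hu. }
  destruct (proj1 (val_prod _ M _ _) _ _ (HM _ eq_refl y y (Hloop y)))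
    as (z & Hb & Hc).
  apply val_prod; exists z; split; trivial.
  apply val_prod; exists z; split.
  - apply val_prod; exists y; auto.
  - apply val_meet; split; trivial.
    (* The loop at [z] passes through [y]: [c] leads from [z] to [y] and [b] leads back. *)
    apply val_prod; exists y; auto.
Qed.

Lemma not_strongly_complete k (Mods : square_Rmodel k -> Prop) :
  ~ strongly_complete Mods.
Proof.
  intros HC; apply (conclusion_not_derivable k 0 1 2 3).
  - repeat constructor; simpl; intuition discriminate.
  - apply HC, conclusion_semantically_follows.
Qed.

Theorem theorem4p1 :
  (forall a b c d : nat, NoDup [a; b; c; d] ->
     (forall k : bool,
        semantically_follows any_square
          (eq (@hypothesis k a b c)) (@conclusion k a b c d)) /\
     ~ derivable (eq (@hypothesis true a b c)) (@conclusion true a b c d)) /\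
  ~ strongly_complete (@any_square false) /\
  ~ strongly_complete nonstandard_square.
Proof.
  split; [|split; apply not_strongly_complete].
  intros a b c d Hd; split.
  - intros k; apply conclusion_semantically_follows.
  - now apply conclusion_not_derivable.
Qed.
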